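(* Let $d\ge1$, $\gamma>1$, $1<r<\infty$, and suppose that $$2\beta>\frac{d(\gamma-1)}{r}.$$ Then there is a constant $C$, depending only on $d,\gamma,\beta,r,t_0$ and on the fixed averaging kernel $\eta$, such that for every nonnegative $w\in L^r(\mathbb{R}^d)$, $$\|M_{\log,\gamma,\beta}w\|_{L^r(\mathbb{R}^d)}\le C\|w\|_{L^r(\mathbb{R}^d)}.$$ For $r=\infty$, the same conclusion holds whenever $\beta\ge0$.
   Context: $t_0$ is a fixed number of the form $t_0=2^{-k_1}<e^{-1}$ with $k_1$ an integer, and $a_\gamma(t)=t(\log(1/t))^{\gamma-1}$ for $0<t<e^{-1}$. $\eta$ is a fixed nonnegative radial Schwartz function on $\mathbb{R}^d$ with $\int\eta=1$ and $\eta\ge c\,\mathbf 1_{B(0,1)}$ for some $c>0$; $\eta_t(x)=t^{-d}\eta(x/t)$ and $A_tw=\eta_t*w$. For nonnegative locally integrable $w$ the logarithmic geometric maximal operator is $$M_{\log,\gamma,\beta}w(x)=\sup_{\substack{0<t<t_0\\|y-x|\le a_\gamma(t)}}(\log(1/t))^{-2\beta}A_tw(y).$$ *)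

(* Defs.v *)
From HB Require Import structures.
From mathcomp Require Import all_boot all_order all_algebra.
From mathcomp Require Import all_classical all_reals all_analysis.

Set Implicit Arguments.
Unset Strict Implicit.
Unset Printing Implicit Defensive.

Import Order.TTheory GRing.Theory Num.Theory.
Import numFieldNormedType.Exports.

Local Open Scope classical_set_scope.
Local Open Scope ring_scope.

(* ['rV[R]_n] carries the product sigma-algebra, generated by the preimages of
   Borel sets under the coordinates; it is the Borel sigma-algebra, see
   [measurable_rV_borel]. *)
Definition rV_coord (R : realType) (n : nat) (i : 'I_n) (x : 'rV[R]_n) :
  measurableTypeR R := x ord0 i.

Definition measurable_rV (R : realType) (n : nat) : set (set 'rV[R]_n) :=
  <<s \bigcup_(i in [set: 'I_n]) preimage_set_system setT (@rV_coord R n i)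
        (@measurable _ (measurableTypeR R)) >>.

Definition rV_display : measure_display.
Proof. exact: default_measure_display. Qed.

HB.instance Definition _ (R : realType) (n : nat) :=
  @isMeasurable.Build rV_display 'rV[R]_n (@measurable_rV R n)
    (@sigma_algebra0 _ _ _) (@sigma_algebraC _ _) (@sigma_algebra_bigcup _ _ _).

Lemma measurable_rV_coord (R : realType) (n : nat) (i : 'I_n) :
  measurable_fun setT (@rV_coord R n i).
Proof.
move=> _ Y mY; apply: sub_sigma_algebra; exists i => //.
by exists Y.
Qed.

Lemma measurable_fun_rV d (T : measurableType d) (R : realType) (n : nat)
    (f : T -> 'rV[R]_n) :
  (forall i, measurable_fun setT (@rV_coord R n i \o f)) ->
  measurable_fun setT f.
Proof.
move=> mf _ Y mY.
pose S := [set A : set 'rV[R]_n | measurable (setT `&` f @^-1` A)].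
suff: @measurable_rV R n `<=` S by exact.
apply: smallest_sub.
  split => /=.
  - by rewrite /S /= preimage_set0 setI0.
  - move=> A; rewrite /S /= !setTI setTD => mA.
    by rewrite preimage_setC; exact: measurableC.
  - move=> F; rewrite /S /= => mF; rewrite setTI preimage_bigcup.
    by apply: bigcupT_measurable => k; rewrite -[_ @^-1` _]setTI; exact: mF.
move=> _ [i _ [B mB <-]]; rewrite /S /= !setTI.
by rewrite -comp_preimage -[_ @^-1` _]setTI; exact: mf.
Qed.

Definition rV_rcons (R : realType) (n : nat)
    (p : 'rV[R]_n * measurableTypeR R) : 'rV[R]_n.+1 :=
  \row_(i < n.+1) if unlift ord_max i is Some j then p.1 ord0 j else p.2.

Lemma measurable_rV_rcons (R : realType) (n : nat) :
  measurable_fun setT (@rV_rcons R n).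
Proof.
apply: measurable_fun_rV => i.
case: (unliftP ord_max i) => [j|] ->.
  rewrite (_ : _ \o _ = @rV_coord R n j \o fst).
    by apply: measurableT_comp => //; exact: measurable_rV_coord.
  by apply/funext => p; rewrite /= /rV_coord mxE liftK.
rewrite (_ : _ \o _ = snd) //.
by apply/funext => p; rewrite /= /rV_coord mxE unlift_none.
Qed.

Section lebesgue_rV.
Variable R : realType.
Local Open Scope ereal_scope.

Definition lebesgue_rV_rcons (n : nat)
    (mu : {measure set 'rV[R]_n -> \bar R}) :
    {measure set 'rV[R]_n.+1 -> \bar R} :=
  measure_function_pushforward__canonical__measure_function_Measure
    (mu \x lebesgue_measure : {measure set _ -> \bar R}) (@measurable_rV_rcons R n).

(* iterated product of [lebesgue_measure]; see [lebesgue_rV_box] *)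
Fixpoint lebesgue_rV (n : nat) : {measure set 'rV[R]_n -> \bar R} :=
  match n with
  | 0 => dirac (0 : 'rV[R]_0)%R
  | m.+1 => lebesgue_rV_rcons (lebesgue_rV m)
  end.

Lemma lebesgue_rV_box (n : nat) (A : 'I_n -> set (measurableTypeR R)) :
  (forall i, measurable (A i)) ->
  lebesgue_rV n [set x | forall i, A i (rV_coord i x)] =
  \big[*%E/1]_(i < n) lebesgue_measure (A i).
Proof.
elim: n A => [|n ih] A mA.
  rewrite big_ord0 /= diracE (_ : _ \in _ = true)//.
  by apply/mem_set => -[].
rewrite big_ord_recr /= /pushforward.
rewrite (_ : _ @^-1` _ =
  [set x | forall i : 'I_n, A (widen_ord (leqnSn n) i) (rV_coord i x)]
    `*` A ord_max); last first.
  apply/seteqP; split => -[x y] /=.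
    move=> h; split => [i|].
      have := h (lift ord_max i); rewrite /rV_coord mxE liftK.
      by congr (A _ _); apply/val_inj; rewrite /= /bump leqNgt ltn_ord.
    by have := h ord_max; rewrite /rV_coord mxE unlift_none.
  move=> [hx hy] i; rewrite /rV_coord mxE; case: unliftP => [j|] ->//=.
  have := hx j; congr (A _ _).
  by apply/val_inj; rewrite /= /bump leqNgt ltn_ord.
rewrite product_measure1E//.
  by rewrite (ih (fun i => A (widen_ord (leqnSn n) i))).
rewrite (_ : [set _ | _] = \bigcap_(i in [set: 'I_n])
    (@rV_coord R n i @^-1` A (widen_ord (leqnSn n) i))); last first.
  by apply/seteqP; split => x /= h i; [move=> _|]; exact: h.
apply: fin_bigcap_measurable => // i _.
by rewrite -[_ @^-1` _]setTI; exact: measurable_rV_coord.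
Qed.

End lebesgue_rV.

Lemma measurable_rV_borel (R : realType) (n : nat) :
  @measurable _ 'rV[R]_n = <<s [set U : set 'rV[R]_n | open U] >>.
Proof.
apply/seteqP; split.
  apply: smallest_sub; first exact: smallest_sigma_algebra.
  move=> _ [i _ [B mB <-]]; rewrite setTI.
  move: mB; rewrite /= measurable_realfun.RGenOInfty.measurableE => mB.
  pose S := [set B : set R | <<s [set U : set 'rV[R]_n | open U] >>
                               ((fun x : 'rV[R]_n => x ord0 i) @^-1` B)].
  suff: <<s @measurable_realfun.RGenOInfty.G R >> `<=` S by exact.
  apply: smallest_sub.
    split => /=.
    - by rewrite /S /= preimage_set0; exact: sigma_algebra0.
    - move=> C; rewrite /S /= setTD => mC.
      by rewrite preimage_setC; exact: sigma_algebraC.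
    - by move=> F mF; rewrite /S /= preimage_bigcup; exact: sigma_algebra_bigcup.
  move=> _ [x ->]; rewrite /S /=; apply: sub_sigma_algebra => /=.
  apply: open_comp => [z _|]; first exact: coord_continuous.
  exact: interval_open.
apply: smallest_sub; first exact: sigma_algebra_measurable.
move=> U /= oU.
pose B (p : 'rV[rat]_n * nat) : set 'rV[R]_n :=
  [set x | forall i, `|ratr (p.1 ord0 i) - x ord0 i| < p.2.+1%:R^-1].
have -> : U = \bigcup_(p in [set: 'rV[rat]_n * nat])
    (if `[< B p `<=` U >] then B p else set0).
  apply/seteqP; split => [x Ux|x [p _]]; last by case: asboolP => // + Bx; exact.
  have /nbhs_ballP[e /= e0 eU] : nbhs x U by exact: open_nbhs_nbhs.
  have [k ke] : exists k : nat, k.+1%:R^-1 < e / 2.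
    have e20 : 0 < e / 2 by rewrite divr_gt0.
    exists (Num.truncn (e / 2)^-1).
    rewrite -[ltRHS]invrK ltf_pV2 ?posrE ?invr_gt0//.
    by rewrite truncnS_gt.
  have /choice[q hq] : forall i : 'I_n, exists q : rat,
      `|ratr q - x ord0 i| < k.+1%:R^-1.
    move=> i; have k0 : (0 : R) < k.+1%:R^-1 by rewrite invr_gt0.
    have /rat_in_itvoo[q] : x ord0 i - k.+1%:R^-1 < x ord0 i + k.+1%:R^-1.
      by rewrite ltrBlDr -addrA ltrDl addr_gt0.
    rewrite in_itv /= => /andP[q1 q2]; exists q.
    by rewrite ltr_norml ltrBrDl q1 ltrBlDl q2.
  have BU : B (\row_i q i, k) `<=` U.
    move=> y By; apply: eU; split => // i j; rewrite ord1 /ball /=.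
    have := By j; rewrite /= mxE => yq.
    rewrite -(subrKA (ratr (q j))) (le_lt_trans (ler_normD _ _))//.
    rewrite [ltRHS](splitr e) ltrD// (lt_trans _ ke)//.
    by rewrite distrC; exact: hq.
  exists (\row_i q i, k) => //; case: asboolP => // _ i /=.
  by rewrite mxE; exact: hq.
apply: countable_bigcupT_measurable => [|p]; first exact: countableP.
case: ifPn => // _.
have -> : B p = \bigcap_(i in [set: 'I_n]) (@rV_coord R n i @^-1`
    [set y : R | `|ratr (p.1 ord0 i) - y| < p.2.+1%:R^-1]).
  by apply/seteqP; split => x /= h i; [move=> _|]; exact: h.
apply: fin_bigcap_measurable => // i _.
rewrite -[_ @^-1` _]setTI; apply: measurable_rV_coord => //.
have -> : [set y : R | `|ratr (p.1 ord0 i) - y| < p.2.+1%:R^-1] =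
    ball (ratr (p.1 ord0 i) : R) p.2.+1%:R^-1 by [].
by apply: measurable_realfun.open_measurable; exact: ball_open.
Qed.

Section maximal_operator.
Variables (R : realType) (d : nat).
Implicit Types (eta f w : 'rV[R]_d -> R) (x y z : 'rV[R]_d) (s : seq 'I_d).

(* the norm [`|x|] of ['rV[R]_d] is the sup norm, hence this definition *)
Definition euclid_norm x : R := Num.sqrt (\sum_(i < d) x ord0 i ^+ 2).

(* differentiates first along the last coordinate of [s] *)
Definition partial s f : 'rV[R]_d -> R :=
  foldr (fun i g x => 'D_(delta_mx ord0 i) g x) f s.

Definition smooth f : Prop := forall s,
  continuous (partial s f) /\
  forall i x, derivable (partial s f) x (delta_mx ord0 i).

Definition schwartz f : Prop := smooth f /\
  forall (m : 'I_d -> nat) s, exists K : R, forall x,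
    `|(\prod_(i < d) x ord0 i ^+ m i) * partial s f x| <= K.

Definition radial f : Prop :=
  forall x y, euclid_norm x = euclid_norm y -> f x = f y.

Definition unit_ball : set 'rV[R]_d := [set x | euclid_norm x < 1].

Definition averaging_kernel eta : Prop :=
  [/\ forall x, 0 <= eta x, radial eta, schwartz eta,
      (\int[lebesgue_rV R d]_x (eta x)%:E = 1)%E &
      exists2 c : R, 0 < c & forall x, c * \1_unit_ball x <= eta x].

Definition dilate eta (t : R) x : R := t ^- d * eta (t^-1 *: x).

(* the convolution [eta_t * w]; it is [\bar R]-valued, and [+oo] is possible for
   a general nonnegative [w] *)
Definition average eta (t : R) w x : \bar R :=
  (\int[lebesgue_rV R d]_z (dilate eta t (x - z) * w z)%:E)%E.

Definition log_aperture (gamma t : R) : R := t * ln (t^-1) `^ (gamma - 1).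

Definition log_maximal eta (t0 gamma beta : R) w x : \bar R :=
  ereal_sup [set v | exists t y,
    [/\ 0 < t, t < t0, euclid_norm (y - x) <= log_aperture gamma t &
        v = ((ln (t^-1) `^ (- (2 * beta)))%:E * average eta t w y)%E]].

End maximal_operator.

(* Main.v *)
Require Import Defs.
From mathcomp Require Import all_boot all_order all_algebra.
From mathcomp Require Import all_classical all_reals all_analysis.
From mathcomp Require Import measurable_realfun ess_sup_inf ring lra.

(* Fix p in [1, r) with d (gamma - 1) / p <= 2 beta, and let M be the
   Hardy-Littlewood maximal operator over cubes.  Widening the aperture of the
   averages of w ^ p from t to lam t, with lam = log (1/t) ^ (gamma - 1), costs a
   factor lam ^ d, so by Hoelder A_t w (y) <= C lam ^ (d / p) (M (w ^ p) x) ^ (1 / p),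
   and the weight log (1/t) ^ (- 2 beta) absorbs lam ^ (d / p).  As r / p > 1, M is
   bounded on L ^ (r / p); this is obtained from the weak (1,1) bound for
   w ^ p 1_{w > s} at the dyadic levels s = 2 ^ k, k in Z.  Working with level sets
   of M avoids measurability questions about the maximal function itself. *)

Import Order.TTheory GRing.Theory Num.Theory.
Import numFieldNormedType.Exports.

Local Open Scope classical_set_scope.
Local Open Scope ring_scope.

(** * Sup-norm cubes, their measure and inclusions *)

Section cubes.
Context {R : realType} {d : nat}.
Implicit Types (c x y : 'rV[R]_d) (rho : R).
Local Notation mu := (lebesgue_rV R d).

(** Open sup-norm balls take the place of Euclidean balls, since their measure factors over the
    coordinates. *)
Definition cube c rho : set 'rV[R]_d :=
  [set x | forall i, `|c ord0 i - x ord0 i| < rho].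

Lemma measurable_cube c rho : measurable (cube c rho).
Proof.
have -> : cube c rho = \bigcap_(i in [set: 'I_d])
    (@rV_coord R d i @^-1` ball (c ord0 i : R) rho).
  by apply/seteqP; split => x /= h i; [move=> _|]; exact: h.
apply: fin_bigcap_measurable => // i _.
rewrite -[_ @^-1` _]setTI; apply: measurable_rV_coord => //.
exact: measurable_ball.
Qed.

Lemma lebesgue_cube c rho : 0 <= rho -> mu (cube c rho) = ((2 * rho) ^+ d)%:E.
Proof.
move=> rho0.
rewrite (lebesgue_rV_box
    (A := fun i => (ball (c ord0 i : R) rho : set (measurableTypeR R)))); last first.
  by move=> i; exact: measurable_ball.
under eq_bigr do rewrite lebesgue_measure_ball//.
rewrite -[X in _ ^+ X](card_ord d) -prodr_const mulr_natl.
apply: (big_ind2 (fun (u : \bar R) v => u = v%:E)) => // _ u _ v -> ->.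
by rewrite EFinM.
Qed.

Lemma sub_cube c x rho rho' delta :
  (forall i, `|c ord0 i - x ord0 i| <= delta) -> rho + delta <= rho' ->
  cube c rho `<=` cube x rho'.
Proof.
move=> cx le_rho y cy i; apply: lt_le_trans le_rho.
rewrite -(subrKA (c ord0 i)) (le_lt_trans (ler_normD _ _))// addrC.
by rewrite ltr_leD// ?cy// distrC.
Qed.

Lemma sub_cube3 c x rho rho' : cube c rho `&` cube x rho' !=set0 ->
  rho <= rho' -> cube c rho `<=` cube x (3 * rho').
Proof.
move=> [y [cy xy]] le_rho; apply: (@sub_cube _ _ _ _ (rho + rho')); last lra.
move=> i; rewrite -(subrKA (y ord0 i)) (le_trans (ler_normD _ _))//.
by rewrite lerD// ltW ?cy// distrC xy.
Qed.

End cubes.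

(* [\int] of a nonnegative function is a supremum over simple minorants, so it is
   monotone without any measurability. *)
Lemma ge0_le_lower_integral d (T : measurableType d) (R : realType)
    (nu : {measure set T -> \bar R}) (f1 f2 : T -> \bar R) :
  (forall x, 0 <= f1 x)%E -> (forall x, f1 x <= f2 x)%E ->
  (\int[nu]_x f1 x <= \int[nu]_x f2 x)%E.
Proof.
move=> f10 f12; rewrite !ge0_integralTE//; last first.
  by move=> x; exact: le_trans (f12 x).
apply: le_ereal_sup => _ [h hf1 <-]; exists h => // x.
exact: le_trans (f12 x).
Qed.

(** * Vitali selection for finite families of cubes *)

Section vitali.
Context {R : realType} {d : nat}.
Implicit Types (c x y : 'rV[R]_d) (rho : R).
Local Notation mu := (lebesgue_rV R d).

Lemma max_radius (s : seq ('rV[R]_d * R)) : s != [::] ->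
  exists2 B, B \in s & forall B', B' \in s -> B'.2 <= B.2.
Proof.
elim: s => // B [_ _|B' s /(_ isT)[B'' B''s hB'' _]].
  by exists B; rewrite ?mem_head// => C; rewrite inE => /eqP->.
have [le_BB''|lt_B''B] := leP B.2 B''.2.
  exists B''; first by rewrite inE B''s orbT.
  by move=> C; rewrite inE => /predU1P[->//|]; exact: hB''.
exists B; first exact: mem_head.
by move=> C; rewrite inE => /predU1P[->//|/hB'']; move/le_trans; apply; exact: ltW.
Qed.

Local Open Scope ereal_scope.

(* Keep the largest cube, discard those meeting it (they lie in its triple), and
   recurse inside the complement of that cube. *)
Lemma vitali_integral (g : 'rV[R]_d -> R) (a : R) (s : seq ('rV[R]_d * R)) A :
  (0 <= a)%R -> measurable_fun setT g -> (forall x, 0 <= g x)%R ->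
  measurable A ->
  (forall B, B \in s -> [/\ (0 < B.2)%R, cube B.1 B.2 `<=` A &
    a%:E * mu (cube B.1 B.2) <= \int[mu]_(x in cube B.1 B.2) (g x)%:E]) ->
  a%:E * mu (\big[setU/set0]_(B <- s) cube B.1 B.2) <=
    (3 ^+ d)%:E * \int[mu]_(x in A) (g x)%:E.
Proof.
move=> a0 mg g0.
have [n] := ubnP (size s); elim: n s A => // n ih s A + mA hs.
have [->|s0 ltsn] := eqVneq s [::].
  move=> _; rewrite big_nil measure0 mule0 mule_ge0//.
  by apply: integral_ge0 => x _; rewrite lee_fin.
have [B Bs hB] := max_radius s s0.
have [B0 BA aB] := hs _ Bs.
pose far (C : 'rV[R]_d * R) := `[< cube C.1 C.2 `&` cube B.1 B.2 = set0 >].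
pose s' := [seq C <- s | far C].
have mcubes (t : seq ('rV[R]_d * R)) :
    measurable (\big[setU/set0]_(C <- t) cube C.1 C.2).
  by apply: bigsetU_measurable => C _; exact: measurable_cube.
have mB := measurable_cube B.1 B.2; have mAB := measurableD mA mB.
(* The kept cube contains its own centre, hence meets itself and is filtered out too; so the
   recursion terminates. *)
have s's : (size s' < size s)%N.
  rewrite size_filter -(count_predC far) -[ltnLHS]addn0 ltn_add2l -has_count.
  apply/hasP; exists B => //=; apply/negP => /asboolP; rewrite setIid => cB0.
  have : cube B.1 B.2 B.1.
    by move=> i; rewrite subrr normr0.
  by rewrite cB0.
have ih' : a%:E * mu (\big[setU/set0]_(C <- s') cube C.1 C.2) <=
    (3 ^+ d)%:E * \int[mu]_(x in A `\` cube B.1 B.2) (g x)%:E.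
  apply: ih => //; first exact: leq_trans s's ltsn.
  move=> C; rewrite mem_filter => /andP[/asboolP CB /hs[C0 CA aC]]; split => //.
  move=> x Cx; split; first exact: CA.
  by move=> Bx; have : set0 x by rewrite -CB.
apply: (@le_trans _ _ (a%:E * (mu (cube B.1 (3 * B.2)) +
    mu (\big[setU/set0]_(C <- s') cube C.1 C.2)))).
  rewrite lee_wpmul2l ?lee_fin//.
  apply: le_trans (measureU2 _ _ _) => //; last exact: measurable_cube.
  rewrite le_measure ?inE//.
    by apply: measurableU => //; exact: measurable_cube.
  rewrite -!bigcup_seq => x [C /= Cs Cx].
  have [farC|/asboolPn /eqP /set0P CB] := boolP (far C).
    by right; exists C => //=; rewrite mem_filter farC.
  by left; apply: sub_cube3 CB _ _ Cx; exact: hB.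
rewrite ge0_muleDr//.
have -> : \int[mu]_(x in A) (g x)%:E = \int[mu]_(x in cube B.1 B.2) (g x)%:E +
    \int[mu]_(x in A `\` cube B.1 B.2) (g x)%:E.
  rewrite -[in LHS](setDUK BA) ge0_integral_setU//.
  - by apply/measurable_EFinP; exact: measurable_funTS.
  - by move=> x _; rewrite lee_fin.
  - by rewrite disj_set2E setDIK.
have int0 D : 0 <= \int[mu]_(x in D) (g x)%:E.
  by apply: integral_ge0 => x _; rewrite lee_fin.
rewrite ge0_muleDr// leeD//.
(* The tripled cube has [3 ^ d] times the measure of the kept one, whence the constant. *)
apply: le_trans (lee_wpmul2l _ aB); last by [].
have B0' := ltW B0.
rewrite !lebesgue_cube ?mulr_ge0// -!EFinM lee_fin [(2 * (3 * _))%R]mulrCA exprMn.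
by rewrite mulrCA.
Qed.
End vitali.

(** * Weak (1,1) bounds for the cube maximal function *)

Section superlevel.
Context {R : realType} {d : nat}.
Implicit Types (c x y : 'rV[R]_d) (rho : R) (g : 'rV[R]_d -> R) (a : R).
Local Notation mu := (lebesgue_rV R d).
Local Open Scope ereal_scope.

Definition rat_cube (p : 'rV[rat]_d * rat) : set 'rV[R]_d :=
  cube (map_mx ratr p.1) (ratr p.2).

Definition heavy g a (p : 'rV[rat]_d * rat) : Prop :=
  (0 < ratr p.2 :> R)%R /\
  a%:E * mu (rat_cube p) < \int[mu]_(x in rat_cube p) (g x)%:E.

(* The set where the maximal function over rational cubes exceeds [a]; having only
   countably many cubes replaces inner regularity in the proof of [weak_type]. *)
Definition superlevel g a : set 'rV[R]_d :=
  \bigcup_(p in heavy g a) rat_cube p.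

Lemma measurable_superlevel g a : measurable (superlevel g a).
Proof.
rewrite /superlevel bigcup_mkcond.
apply: countable_bigcupT_measurable => [|p]; first exact: countableP.
by case: ifPn => // _; exact: measurable_cube.
Qed.

(** [vitali_integral] bounds all finite families of heavy cubes uniformly; continuity of the measure
    from below passes to their countable union. *)
Lemma weak_type g a : (0 <= a)%R -> measurable_fun setT g ->
  (forall x, 0 <= g x)%R ->
  a%:E * mu (superlevel g a) <= (3 ^+ d)%:E * \int[mu]_x (g x)%:E.
Proof.
move=> a0 mg g0.
(* Heavy cubes with code below [n]: their unions [F n] increase to the superlevel set. *)
pose s n := [seq p : 'rV[rat]_d * rat <- pmap unpickle (iota 0 n)
                 | `[< heavy g a p >]].
pose F n := \big[setU/set0]_(p <- s n) rat_cube p.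
have mF n : measurable (F n).
  by apply: bigsetU_measurable => p _; exact: measurable_cube.
have FE : superlevel g a = \bigcup_n F n.
  apply/seteqP; split => [x [p hp px]|x [n _]].
    exists (pickle p).+1 => //; rewrite /F -bigcup_seq; exists p => //=.
    rewrite mem_filter mem_pmap; apply/andP; split; first exact/asboolP.
    by apply/mapP; exists (pickle p); rewrite ?pickleK// mem_iota leqnn.
  rewrite /F -bigcup_seq => -[p /=]; rewrite mem_filter => /andP[/asboolP hp _] px.
  by exists p.
have ndF : {homo F : n m / (n <= m)%N >-> (n <= m)%O}.
  move=> n m nm; apply/subsetPset; rewrite /F -!bigcup_seq => x [p /= ps px].
  exists p => //=; move: ps; rewrite !mem_filter !mem_pmap => /andP[-> /mapP[k]].
  rewrite mem_iota add0n => /andP[_ kn] ->; apply/mapP; exists k => //.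
  by rewrite mem_iota (leq_trans kn nm).
have muF : mu (F n) @[n --> \oo] --> mu (superlevel g a).
  rewrite FE; apply: nondecreasing_cvg_mu => //.
  by rewrite -FE; exact: measurable_superlevel.
rewrite -(cvg_lim _ muF)// -limeMl//; last by apply/cvg_ex; eexists; exact: muF.
apply: lime_le.
  by apply: is_cvgeMl => //; apply/cvg_ex; eexists; exact: muF.
apply: nearW => n.
pose t := [seq (map_mx ratr p.1 : 'rV[R]_d, ratr p.2 : R) | p <- s n].
have -> : F n = \big[setU/set0]_(B <- t) cube B.1 B.2 by rewrite big_map.
apply: vitali_integral => // B /mapP[p].
rewrite mem_filter => /andP[/asboolP[p0 hp] _] -> /=.
by split => //; exact: ltW.
Qed.

(** Values of [g] up to [a] contribute at most [a] to an average. A cube with average above [2 * a]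
    thus still has average above [a] for [g] cut off to [g > a], and [weak_type] applies to this
    cutoff. *)
Lemma superlevel2_weak_type g a : (0 < a)%R -> measurable_fun setT g ->
  (forall x, 0 <= g x)%R ->
  a%:E * mu (superlevel g (2 * a)) <=
    (3 ^+ d)%:E * \int[mu]_(x in [set x | (a < g x)%R]) (g x)%:E.
Proof.
move=> a0 mg g0.
pose D := [set x | (a < g x)%R].
have mD : measurable D.
  rewrite /D -[X in measurable X]setTI.
  have -> : [set x | (a < g x)%R] = g @^-1` `]a, +oo[.
    by apply/seteqP; split => x /=; rewrite in_itv /= andbT.
  exact: mg.
pose h x := (g x * \1_D x)%R.
have mh : measurable_fun setT h.
  by apply: measurable_funM => //; exact: measurable_indic.
have h0 x : (0 <= h x)%R by rewrite mulr_ge0.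
have -> : \int[mu]_(x in D) (g x)%:E = \int[mu]_x (h x)%:E.
  rewrite integral_mkcond; apply: eq_integral => x _.
  by rewrite patchE /h indicE; case: ifP => _; rewrite ?mulr1 ?mulr0.
apply: le_trans (weak_type _ _ (ltW a0) mh h0).
rewrite lee_wpmul2l ?lee_fin ?(ltW a0)//.
rewrite le_measure ?inE//; [exact: measurable_superlevel..|].
apply: bigcup_subset => p [p0 hp]; split => //.
have mp : measurable (rat_cube p) by exact: measurable_cube.
have mfT (f : 'rV[R]_d -> R) (A : set 'rV[R]_d) : measurable_fun setT f ->
    measurable_fun A (EFin \o f).
  by move=> mf; apply/measurable_EFinP; exact: measurable_funTS.
have : \int[mu]_(x in rat_cube p) (g x)%:E <=
    a%:E * mu (rat_cube p) + \int[mu]_(x in rat_cube p) (h x)%:E.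
  rewrite -integral_cst// -ge0_integralD//; last 3 first.
  - by move=> x _; rewrite lee_fin ltW.
  - by move=> x _; rewrite lee_fin.
  - exact: mfT.
  apply: ge0_le_integral => //.
    + by move=> x _; rewrite lee_fin.
    + exact: mfT.
    + by apply: emeasurable_funD => //; exact: mfT.
    + move=> x _; rewrite -EFinD lee_fin /h indicE.
      have [xD|xD] := boolP (x \in D); first by rewrite mulr1 lerDr ltW.
      rewrite mulr0 addr0 leNgt; apply: contra xD => ax; exact/mem_set.
move/(lt_le_trans hp); rewrite mulr_natl mulr2n EFinD.
rewrite ge0_muleDl ?lee_fin ?(ltW a0)//.
(* Cancelling the common term is legitimate because a cube has finite measure. *)
rewrite lteD2lE//.
by rewrite /rat_cube lebesgue_cube ?ltW.
Qed.

(* The factor [4] instead of [2] pays for the passage to a rational cube. *)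
Lemma superlevelN_le g a x rho : (0 < rho)%R -> (0 <= a)%R ->
  measurable_fun setT g -> (forall x, 0 <= g x)%R -> ~ superlevel g a x ->
  \int[mu]_(z in cube x rho) (g z)%:E <= (a * (4 * rho) ^+ d)%:E.
Proof.
move=> rho0 a0 mg g0 xa.
have /choice[q hq] : forall i, exists q : rat, (`|x ord0 i - ratr q| <= rho / 2)%R.
  move=> i; have /rat_in_itvoo[q] : (x ord0 i < x ord0 i + rho / 2)%R.
    by rewrite ltrDl divr_gt0.
  rewrite in_itv /= => /andP[q1 q2]; exists q.
  rewrite distrC ger0_norm ?subr_ge0 ?(ltW q1)//; lra.
(* The lower bound absorbs the shift of the centre by [rho / 2]; the upper one keeps the side below
   [4 * rho]. *)
have /rat_in_itvoo[e] : (rho * 3 / 2 < 2 * rho)%R by lra.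
rewrite in_itv /= => /andP[e1 e2].
pose p := (\row_i q i, e).
have e0 : (0 < ratr e :> R)%R by lra.
have sub_p : cube x rho `<=` rat_cube p.
  rewrite /rat_cube; apply: (@sub_cube _ _ _ _ _ _ (rho / 2)%R); last first.
    by rewrite /=; lra.
  by move=> i; rewrite !mxE.
have xp : rat_cube p x by apply: sub_p => i; rewrite subrr normr0.
apply: (@le_trans _ _ (\int[mu]_(z in rat_cube p) (g z)%:E)).
  apply: ge0_subset_integral => //; [exact: measurable_cube..| |].
  - by apply/measurable_EFinP; exact: measurable_funTS.
  - by move=> z _; rewrite lee_fin.
have : ~ heavy g a p by move=> hp; apply: xa; exists p.
move/not_andP => -[//|/negP]; rewrite -leNgt => /le_trans; apply.
rewrite /rat_cube lebesgue_cube ?(ltW e0)// -EFinM lee_fin ler_wpM2l//.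
apply: lerXn2r; rewrite ?nnegrE /=; lra.
Qed.

End superlevel.

(** * Geometric sums over the dyadic levels below a threshold *)

Section dyadic.
Context {R : realType}.
Implicit Types (b : bool) (n m : nat) (q A u : R).

(* [b] selects the nonnegative or the nonpositive powers of [2]. *)
Definition dyadic b n : R := (if b then 2 else 2^-1) ^+ n.

Lemma dyadic_gt0 b n : 0 < dyadic b n.
Proof. by rewrite exprn_gt0//; case: b. Qed.

(** Take the least [n] with [u < 2 ^ n] if [1 <= u], the least [n] with [2 ^ (- n) <= u] otherwise.
    It is never 0, and minimality at its predecessor gives the other bound. *)
Lemma dyadic_approx u : 0 < u -> exists b n, dyadic b n <= u < 2 * dyadic b n.
Proof.
move=> u0; have [u1|u1] := leP 1 u.
  have /ex_minnP[[|n] un min_n] : exists n, u < 2 ^+ n.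
  - by exists (Num.Def.archi_bound u); exact: upper_nthrootP.
  - by move: un; rewrite expr0 ltNge u1.
  exists true, n; rewrite /dyadic -exprS un andbT leNgt; apply/negP => /min_n.
  by rewrite ltnn.
have /ex_minnP[[|n] un min_n] : exists n, 2^-1 ^+ n <= u.
- exists (Num.Def.archi_bound u^-1).
  rewrite exprVn invf_ple ?posrE ?exprn_gt0//.
  by rewrite ltW//; exact: upper_nthrootP.
- by move: un; rewrite expr0 leNgt u1.
exists false, n.+1; rewrite /dyadic un/= exprS mulrA divff// mul1r ltNge.
by apply/negP => /min_n; rewrite ltnn.
Qed.

(** If the last term is kept, the full geometric sum is at most its next power divided by [rho - 1],
    and that power is below [rho * A]; otherwise induct. *)
Lemma truncated_geometric (rho A : R) m : 1 < rho -> 0 <= A ->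
  \sum_(n < m) (if rho ^+ n < A then rho ^+ n else 0) <= rho / (rho - 1) * A.
Proof.
move=> rho1 A0.
have rho0 : 0 < rho by lra.
elim: m => [|m ih]; first by rewrite big_ord0 mulr_ge0// divr_ge0; lra.
rewrite big_ord_recr /=; case: ifPn => [mA|_]; last by rewrite addr0.
apply: (@le_trans _ _ (\sum_(n < m.+1) rho ^+ n)).
  rewrite big_ord_recr /= lerD2r ler_sum// => i _.
  by case: ifPn => // _; rewrite exprn_ge0// ltW.
have : (rho - 1) * \sum_(n < m.+1) rho ^+ n = rho ^+ m.+1 - 1 by rewrite subrX1.
rewrite exprS => h; rewrite mulrAC ler_pdivlMr ?subr_gt0// mulrC h.
have : rho * rho ^+ m < rho * A by rewrite ltr_pM2l.
lra.
Qed.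

(** If [1 < A], the whole series is small enough. Otherwise the term of index 0 drops out and a
    shift of index replaces [A] by [rho * A], so the induction is on [m] for all [A]. *)
Lemma truncated_geometricV (rho A : R) m : 1 < rho -> 0 <= A ->
  \sum_(n < m) (if rho^-1 ^+ n < A then rho^-1 ^+ n else 0) <=
  rho / (rho - 1) * A.
Proof.
move=> rho1; have rho0 : 0 < rho by lra.
have C0 : 0 <= rho / (rho - 1) by rewrite divr_ge0; lra.
have CE : rho / (rho - 1) = 1 + rho^-1 * (rho / (rho - 1)).
  by field; rewrite subr_eq0 !gt_eqF.
have sumC k : \sum_(n < k) rho^-1 ^+ n <= rho / (rho - 1).
  elim: k => [|k ih]; first by rewrite big_ord0.
  rewrite big_ord_recl expr0 [leRHS]CE lerD2l.
  under eq_bigr do rewrite /= /bump /= add1n exprS.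
  by rewrite -mulr_sumr ler_wpM2l// invr_ge0 ltW.
elim: m A => [|m ih] A A0; first by rewrite big_ord0 mulr_ge0.
have [A1|A1] := ltP 1 A.
  apply: (@le_trans _ _ (\sum_(n < m.+1) rho^-1 ^+ n)).
    apply: ler_sum => i _; case: ifPn => // _.
    by rewrite exprn_ge0// invr_ge0 ltW.
  by apply: le_trans (sumC _) _; rewrite ler_peMr// ltW.
rewrite big_ord_recl expr0 ltNge A1 /= add0r.
have ihA := ih _ (mulr_ge0 (ltW rho0) A0).
rewrite (eq_bigr (fun n : 'I_m => rho^-1 *
    (if rho^-1 ^+ n < rho * A then rho^-1 ^+ n else 0))); last first.
  move=> i _; rewrite /bump /= add1n exprS ltr_pdivrMl//.
  by case: ifP; rewrite ?mulr0.
rewrite -mulr_sumr -ler_pdivlMl ?invr_gt0// invrK (le_trans ihA)//.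
by rewrite mulrCA.
Qed.

(** For [q > 0] this is the sum of the geometric series of ratio [2 ^ (- q)]. *)
Definition dyadic_cst q : R := 2 `^ q / (2 `^ q - 1).

Lemma powRXn (x q : R) n : 0 <= x -> (x ^+ n) `^ q = (x `^ q) ^+ n.
Proof. by move=> x0; rewrite -!powR_mulrn ?powR_ge0// powRAC. Qed.

Lemma dyadic_sum b q A m : 0 < q -> 0 <= A ->
  \sum_(n < m) (if dyadic b n < A then dyadic b n `^ q else 0) <=
  dyadic_cst q * A `^ q.
Proof.
move=> q0 A0.
have q1 : 1 < 2 `^ q :> R.
  have := @gt0_ltr_powR R q q0 1 2; rewrite powR1; apply; rewrite ?nnegrE//.
  by rewrite ltr1n.
have V2 : (2^-1) `^ q = (2 `^ q)^-1 :> R.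
  apply: (mulIf (lt0r_neq0 (lt_trans ltr01 q1))).
  by rewrite mulVf ?gt_eqF ?powR_gt0// -powRM// mulVf// powR1.
have E n : (dyadic b n < A) = (dyadic b n `^ q < A `^ q).
  apply/idP/idP; first by apply: gt0_ltr_powR; rewrite ?nnegrE// ltW ?dyadic_gt0.
  apply: contraTT; rewrite -!leNgt; apply: ge0_ler_powR; rewrite ?nnegrE//.
  - exact: ltW.
  - by rewrite ltW// dyadic_gt0.
have PX n : dyadic b n `^ q = ((if b then 2 else 2^-1) `^ q) ^+ n.
  by rewrite powRXn//; case: b {E}.
under eq_bigr do rewrite E PX.
case: b {E PX}; first by apply: truncated_geometric => //; exact: powR_ge0.
by rewrite V2; apply: truncated_geometricV => //; exact: powR_ge0.
Qed.
End dyadic.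

(** * A layered majorant and its integral *)

Section layers.
Context {R : realType} {d : nat}.
Implicit Types (x : 'rV[R]_d) (b : bool).
Local Notation mu := (lebesgue_rV R d).
Context (p r : R) (w : 'rV[R]_d -> R) (p1 : 1 <= p) (pr : p < r).
Context (mw : measurable_fun setT w) (w0 : forall x, 0 <= w x).

(** Up to constants, the set where [(M (w ^ p)) ^ (1 / p)] exceeds [s]; the factor 2 matches
    [superlevel2_weak_type]. *)
Definition exceptional (s : R) : set 'rV[R]_d :=
  superlevel (fun x => w x `^ p) (2 * s `^ p).

(** A discrete layer-cake sum, serving as a measurable substitute for [(M (w ^ p)) ^ (r / p)]. The
    two values of [b] cover all dyadic levels; level 1 is counted twice, which is harmless. *)
Definition layers b x : \bar R :=
  (\sum_(n <oo) (dyadic b n `^ r * \1_(exceptional (dyadic b n)) x)%:E)%E.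

Lemma measurable_powRw (q : R) : measurable_fun setT (fun x => w x `^ q).
Proof. exact: (@measurableT_comp _ _ _ _ _ _ (@powR R ^~ q)). Qed.

Lemma layers_ge0 b x : (0 <= layers b x)%E.
Proof.
by apply: nneseries_ge0 => n _ _; rewrite lee_fin mulr_ge0// powR_ge0.
Qed.

Lemma measurable_layers b : measurable_fun setT (layers b).
Proof.
apply: ge0_emeasurable_sum => [n x _ _|n _].
  by rewrite lee_fin mulr_ge0// powR_ge0.
apply/measurable_EFinP; apply: measurable_funM => //.
by apply: measurable_indic; exact: measurable_superlevel.
Qed.

Lemma layers_ge b n x : exceptional (dyadic b n) x ->
  ((dyadic b n `^ r)%:E <= layers b x)%E.
Proof.
move=> xE; rewrite /layers (@nneseriesD1 _ _ n)//; last first.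
  by move=> k _; rewrite lee_fin mulr_ge0// powR_ge0.
rewrite indicE mem_set// mulr1 leeDl// nneseries_ge0// => k _ _.
by rewrite lee_fin mulr_ge0// powR_ge0.
Qed.

(** Marcinkiewicz interpolation: the weak bound turns level [s] into [s ^ (r - p)] times the
    integral of [w ^ p] over [w > s]. Exchanging sum and integral leaves the sum of [s ^ (r - p)]
    over [s < w x], which is of size [w x ^ (r - p)] because [p < r]. *)
Lemma integral_layers b : (\int[mu]_x layers b x <=
  (3 ^+ d * dyadic_cst (r - p))%:E * \int[mu]_x (w x `^ r)%:E)%E.
Proof.
have rp0 : 0 < r - p by rewrite subr_gt0.
have p0 : 0 < p by rewrite (lt_le_trans ltr01).
pose s := @dyadic R b; have s0 n : 0 < s n := dyadic_gt0 b n.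
have mE n : measurable (exceptional (s n)) by exact: measurable_superlevel.
pose D n : set 'rV[R]_d := [set x | s n < w x].
have mD n : measurable (D n).
  rewrite -[X in measurable X]setTI.
  have -> : D n = w @^-1` `]s n, +oo[.
    by apply/seteqP; split => x /=; rewrite in_itv /= andbT.
  exact: mw.
pose f n x := (3 ^+ d * (s n `^ (r - p) * \1_(D n) x * w x `^ p)).
have f0 n x : 0 <= f n x by rewrite !mulr_ge0 ?exprn_ge0 ?powR_ge0.
have mf n : measurable_fun setT (f n).
  apply: measurable_funM => //; apply: measurable_funM; last exact: measurable_powRw.
  by apply: measurable_funM => //; exact: measurable_indic.
apply: (@le_trans _ _ (\sum_(n <oo) \int[mu]_x (f n x)%:E)%E).
  rewrite integral_nneseries//; last 2 first.
  - move=> n; apply/measurable_EFinP; apply: measurable_funM => //.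
  - by move=> n x _; rewrite lee_fin mulr_ge0// powR_ge0.
  apply: lee_nneseries => [n _ _|n _].
    by apply: integral_ge0 => x _; rewrite lee_fin mulr_ge0// powR_ge0.
  under eq_integral do rewrite EFinM.
  rewrite ge0_integralZl_EFin ?powR_ge0//; last first.
    by apply/measurable_EFinP; exact: measurable_indic.
  rewrite integral_indic// setIT.
  (* The factor with exponent [p] is the level used up by the weak bound; the other remains for the
     summation. *)
  have -> : s n `^ r = s n `^ (r - p) * s n `^ p.
    by rewrite -powRD ?subrK// (gt_eqF (s0 n)) implybT.
  have := superlevel2_weak_type _ _ (powR_gt0 p (s0 n)) (measurable_powRw p)
    (fun x => powR_ge0 (w x) p).
  have -> : [set x | s n `^ p < w x `^ p] = D n.
    apply/seteqP; split => x /=; last first.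
      by apply: gt0_ltr_powR; rewrite ?nnegrE// ltW.
    apply: contraTT; rewrite -!leNgt; apply: ge0_ler_powR; rewrite ?nnegrE//.
      exact: ltW.
    exact: ltW.
  move=> hweak; rewrite EFinM -muleA.
  apply: (le_trans (lee_wpmul2l _ hweak)); first by rewrite lee_fin powR_ge0.
  rewrite integral_mkcond muleCA muleA -EFinM -ge0_integralZl_EFin//; last 3 first.
  - by move=> x _; rewrite patchE; case: ifP => // _; rewrite lee_fin powR_ge0.
  - rewrite -measurable_restrictT//; apply/measurable_EFinP.
    by apply: measurable_funTS; exact: measurable_powRw.
  - by rewrite mulr_ge0 ?exprn_ge0 ?powR_ge0.
  rewrite le_eqVlt; apply/orP; left; apply/eqP; apply: eq_integral => x _.
  rewrite patchE /f indicE; case: ifP => _; last by rewrite mulr0 mul0r mulr0 mule0.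
  by rewrite mulr1 -EFinM mulrA.
rewrite -integral_nneseries//; last first.
- by move=> n x _; rewrite lee_fin.
- by move=> n; apply/measurable_EFinP.
have K0 : 0 <= dyadic_cst (r - p).
  (* The empty sum at threshold 1 shows that the constant is nonnegative. *)
  have := @dyadic_sum R b (r - p) 1 0 rp0 ler01.
  by rewrite big_ord0 powR1 mulr1.
rewrite -ge0_integralZl_EFin//; last 3 first.
- by move=> x _; rewrite lee_fin powR_ge0.
- by apply/measurable_EFinP; exact: measurable_powRw.
- by rewrite mulr_ge0 ?exprn_ge0.
apply: ge0_le_lower_integral.
  by move=> x; apply: nneseries_ge0 => n _ _; rewrite lee_fin.
move=> x; apply: lime_le.
  by apply: is_cvg_nneseries => n _ _; rewrite lee_fin.
apply: nearW => m; rewrite sumEFin -EFinM lee_fin big_mkord /f -mulr_sumr -mulrA.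
rewrite ler_wpM2l ?exprn_ge0//.
have -> : w x `^ r = w x `^ (r - p) * w x `^ p.
  by rewrite -powRD ?subrK// (gt_eqF (lt_trans p0 pr)).
rewrite -mulr_suml mulrA ler_wpM2r ?powR_ge0//.
apply: le_trans (dyadic_sum b _ _ m rp0 (w0 x)).
rewrite ler_sum// => n _; rewrite indicE; case: ifPn => sw.
  by rewrite mem_set// mulr1.
by rewrite memNset ?mulr0//; exact/negP.
Qed.
End layers.

(** * Kernel averages controlled by dyadic cubes *)

Section kernel.
Context {R : realType} {d : nat}.
Implicit Types (w eta : 'rV[R]_d -> R).
Local Notation mu := (lebesgue_rV R d).

(** With [j] least, either [j = 0] and boundedness of [eta] suffices, or some coordinate is at least
    [2 ^ (j - 1)] and the Schwartz bound for its power [d + 1] applies. One power beyond [d] makes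
    the sum over [j] in [average_le] converge. *)
Lemma kernel_decay eta : averaging_kernel eta -> exists2 K : R, 0 <= K &
  forall x : 'rV[R]_d, exists2 j : nat, (forall i, `|x ord0 i| < 2 ^+ j) &
    eta x <= K / (2 ^+ j) ^+ d.+1.
Proof.
move=> [eta0 _ [_ eta_schwartz] _ _].
have [K0 hK0] := eta_schwartz (fun=> 0%N) [::].
have /choice[K hK] : forall i : 'I_d, exists K, forall x : 'rV[R]_d,
    `|x ord0 i| ^+ d.+1 * eta x <= K.
  move=> i.
  have [K hK] := eta_schwartz (fun k => if k == i then d.+1 else 0%N) [::].
  exists K => x; apply: le_trans (hK x).
  rewrite /= (bigD1 i)//= eqxx big1 ?mulr1; last first.
    by move=> k /negPf ->.
  by rewrite normrM normrX (ger0_norm (eta0 x)).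
pose M := `|K0| + \sum_i `|K i|.
have M0 : 0 <= M by rewrite addr_ge0// sumr_ge0.
(* The factor [2 ^ (d + 1)] pays for [2 ^ (j - 1)] in place of [2 ^ j]. *)
exists (M * 2 ^+ d.+1); first by rewrite mulr_ge0// exprn_ge0.
move=> x.
have /ex_minnP[j xj min_j] : exists j, [forall i, `|x ord0 i| < 2 ^+ j].
  exists (\max_i Num.Def.archi_bound `|x ord0 i|)%N.
  by apply/forallP => i; apply: upper_nthrootP; exact: leq_bigmax.
exists j; first exact/forallP.
case: j xj min_j => [_ _|j xj min_j].
  rewrite expr0 expr1n divr1.
  have : eta x <= M.
    have := hK0 x; rewrite /= big1// mul1r (ger0_norm (eta0 x)) => /le_trans; apply.
    by rewrite (le_trans (ler_norm _))// lerDl sumr_ge0.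
  by move=> /le_trans; apply; rewrite ler_peMr// exprn_ege1// ler1n.
have /forallPn[i] : ~~ [forall i, `|x ord0 i| < 2 ^+ j].
  by apply/negP => /min_j; rewrite ltnn.
rewrite -leNgt => ji.
rewrite ler_pdivlMr ?exprn_gt0// [2 ^+ j.+1]exprS exprMn mulrCA mulrC.
rewrite ler_wpM2r ?exprn_ge0//.
apply: (@le_trans _ _ (`|x ord0 i| ^+ d.+1 * eta x)).
  rewrite mulrC ler_wpM2r// lerXn2r ?nnegrE ?exprn_ge0//.
rewrite (le_trans (hK i x))// (le_trans (ler_norm _))//.
rewrite /M (bigD1 i)//= addrCA lerDl addr_ge0// sumr_ge0//.
Qed.

(** The decay [2 ^ (- j (d + 1))] of the kernel against the growth [2 ^ (j d)] of the cube integrals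
    leaves [2 ^ (- j)], which is summable. *)
Lemma average_le eta : averaging_kernel eta -> exists2 K : R, 0 < K &
  forall w (t a : R) y, measurable_fun setT w -> (forall x, 0 <= w x) ->
    0 < t -> 0 <= a ->
    (forall j : nat, \int[mu]_(z in cube y (2 ^+ j * t)) (w z)%:E <=
      (a * (2 ^+ j * t) ^+ d)%:E)%E ->
    (average eta t w y <= (K * a)%:E)%E.
Proof.
move=> heta; have [eta0 _ _ _ _] := heta.
have [K K0 hK] := kernel_decay _ heta.
(* The 2 bounds the geometric series; adding 1 makes the constant positive even if [K = 0]. *)
exists (2 * K + 1); first lra.
move=> w t a y mw w0 t0 a0 hw.
pose f j z := K * t ^- d / (2 ^+ j) ^+ d.+1 * (\1_(cube y (2 ^+ j * t)) z * w z).
have c0 j : 0 <= K * t ^- d / (2 ^+ j) ^+ d.+1.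
  by rewrite !mulr_ge0// invr_ge0 !exprn_ge0// ltW.
have f0 j z : 0 <= f j z by rewrite mulr_ge0// mulr_ge0.
have mg j : measurable_fun setT (fun z => \1_(cube y (2 ^+ j * t)) z * w z).
  apply: measurable_funM => //; apply: measurable_indic.
  exact: measurable_cube.
apply: (@le_trans _ _ (\int[mu]_z \sum_(j <oo) (f j z)%:E)%E).
  apply: ge0_le_lower_integral => z.
    by rewrite lee_fin mulr_ge0// mulr_ge0// invr_ge0 exprn_ge0// ltW.
  (* The single term of the [j] attached to [(y - z) / t] already dominates the integrand. *)
  have [j zj hj] := hK (t^-1 *: (y - z)).
  rewrite (@nneseriesD1 _ _ j)//; last by move=> k _; rewrite lee_fin.
  apply: le_trans (leeDl _ _); last first.
    by apply: nneseries_ge0 => k _ _; rewrite lee_fin.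
  rewrite lee_fin /f indicE mem_set ?mul1r ?ler_wpM2r//.
    rewrite /dilate mulrC mulrAC ler_wpM2r// invr_ge0 exprn_ge0// ltW//.
  move=> i; have := zj i; rewrite !mxE normrM gtr0_norm ?invr_gt0//.
  by rewrite ltr_pdivrMl// mulrC.
rewrite integral_nneseries//; last 2 first.
- by move=> j; apply/measurable_EFinP; apply: measurable_funM.
- by move=> j z _; rewrite lee_fin.
apply: (@le_trans _ _ (\sum_(j <oo) (K * a / 2 ^+ j)%:E)%E).
  apply: lee_nneseries => [j _ _|j _].
    by apply: integral_ge0 => z _; rewrite lee_fin.
  under eq_integral do rewrite EFinM.
  rewrite ge0_integralZl_EFin//; last 2 first.
  - by move=> z _; rewrite lee_fin mulr_ge0.
  - exact/measurable_EFinP.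
  have -> : (\int[mu]_z (\1_(cube y (2 ^+ j * t)) z * w z)%:E =
      \int[mu]_(z in cube y (2 ^+ j * t)) (w z)%:E)%E.
    rewrite [RHS]integral_mkcond; apply: eq_integral => z _.
    by rewrite patchE indicE; case: ifP => _; rewrite ?mul1r ?mul0r.
  apply: (le_trans (lee_wpmul2l _ (hw j))); first by rewrite lee_fin.
  rewrite -EFinM lee_fin exprMn exprS.
  have t'0 : t ^+ d != 0 by rewrite expf_neq0// gt_eqF.
  have j0 : (2 ^+ j : R) != 0 by rewrite expf_neq0.
  have j'0 : ((2 ^+ j) ^+ d : R) != 0 by rewrite expf_neq0.
  rewrite le_eqVlt; apply/orP; left; apply/eqP; field.
  by rewrite t'0 j0 j'0.
apply: lime_le.
  apply: is_cvg_nneseries => j _ _.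
  by rewrite lee_fin !mulr_ge0// invr_ge0 exprn_ge0.
apply: nearW => m; rewrite sumEFin lee_fin big_mkord -mulr_sumr.
have : \sum_(i < m) (2 ^+ i)^-1 <= 2 :> R.
  under eq_bigr do rewrite -exprVn.
  elim: m => [|m ih]; first by rewrite big_ord0.
  rewrite big_ord_recl expr0.
  under eq_bigr do rewrite /= /bump /= add1n exprS.
  by rewrite -mulr_sumr; lra.
move=> h; apply: (@le_trans _ _ (K * a * 2)).
  by rewrite ler_wpM2l// mulr_ge0.
rewrite mulrDl mul1r; nra.
Qed.
End kernel.

(** * Pointwise bounds off the exceptional sets, and the essential bound *)

Section pointwise.
Context {R : realType} {d : nat}.
Implicit Types (w eta : 'rV[R]_d -> R) (x y : 'rV[R]_d).
Local Notation mu := (lebesgue_rV R d).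

Lemma coord_le_euclid_norm (x : 'rV[R]_d) i : `|x ord0 i| <= euclid_norm x.
Proof.
rewrite -sqrtr_sqr /euclid_norm ler_wsqrtr// (bigD1 i)//= lerDl.
by rewrite sumr_ge0// => j _; rewrite sqr_ge0.
Qed.

(* Used with a free parameter [a], this stands in for Hoelder's inequality. *)
Lemma le_young (a b p : R) : 0 < a -> 0 <= b -> 1 <= p ->
  b <= a + (a `^ (p - 1))^-1 * b `^ p.
Proof.
move=> a0 b0 p1; have ap0 := powR_gt0 (p - 1) a0.
have [ba|ab] := leP b a.
  by rewrite (le_trans ba)// lerDl mulr_ge0 ?powR_ge0// invr_ge0 ltW.
rewrite (@le_trans _ _ ((a `^ (p - 1))^-1 * b `^ p))//; last first.
  by rewrite lerDr ltW.
rewrite mulrC ler_pdivlMr// -(@mulr_powRB1 _ b p)//; last first.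
  exact: lt_le_trans p1.
rewrite ler_wpM2l// ge0_ler_powR ?nnegrE ?subr_ge0//; exact: ltW.
Qed.

Lemma ln_inv_ge1 (t : R) : 0 < t -> t < expR (- 1) -> 1 <= ln (t^-1).
Proof.
move=> t0 te; rewrite lnV ?posrE// lerNr -(expRK (-1)) ler_ln ?posrE ?expR_gt0//.
exact: ltW.
Qed.

(** For [t <= rho] the cube about [y] lies in the cube of radius [2 * lam * rho] about [x], where
    [w ^ p] has controlled integral. The summands [2 ^ d] and [2 * 8 ^ d] come from the two terms of
    [le_young]. *)
Lemma integral_cube_le p w (s lam t : R) x y :
  1 <= p -> measurable_fun setT w -> (forall z, 0 <= w z) ->
  0 < s -> 1 <= lam -> 0 < t -> ~ exceptional p w s x ->
  (forall i, `|y ord0 i - x ord0 i| <= lam * t) ->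
  forall rho, t <= rho -> (\int[mu]_(z in cube y rho) (w z)%:E <=
    ((2 ^+ d + 2 * 8 ^+ d) * (lam `^ (d%:R / p) * s) * rho ^+ d)%:E)%E.
Proof.
move=> p1 mw w0 s0 lam1 t0 xE yx rho t_rho.
have p0 : 0 < p by rewrite (lt_le_trans ltr01).
have rho0 : 0 < rho by rewrite (lt_le_trans t0).
have lam0 : 0 < lam by rewrite (lt_le_trans ltr01).
(* For this [a], [a ^ p = lam ^ d * s ^ p] is the size of the averages of [w ^ p], so the two terms
   of [le_young] balance. *)
set a := _ * s; have a0 : 0 < a by rewrite mulr_gt0// powR_gt0.
have apE : a `^ p = lam ^+ d * s `^ p.
  rewrite powRM ?powR_ge0 ?(ltW s0)// -powRrM divfK ?gt_eqF//.
  by rewrite powR_mulrn// ltW.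
set c := (a `^ (p - 1))^-1.
have c0 : 0 <= c by rewrite invr_ge0 powR_ge0.
have cE : c * (lam ^+ d * s `^ p) = a.
  rewrite -apE -(@mulr_powRB1 _ a p) ?(ltW a0)// mulrCA mulVf ?mulr1//.
  by rewrite gt_eqF// powR_gt0.
have mwp := measurable_powRw w mw p.
have mrestr (f : 'rV[R]_d -> R) A : measurable_fun setT f ->
    measurable_fun A (EFin \o f).
  by move=> mf; apply/measurable_EFinP; exact: measurable_funTS.
have mcube z e : measurable (@cube R d z e) by exact: measurable_cube.
have intp : (\int[mu]_(z in cube y rho) (w z `^ p)%:E <=
    (2 * s `^ p * (8 * lam * rho) ^+ d)%:E)%E.
  (* The 2 is the enlargement to a cube about [x], the 4 is that of [superlevelN_le]. *)
  have -> : 8 * lam * rho = 4 * (2 * lam * rho) by ring.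
  apply: le_trans (superlevelN_le _ _ _ _ _ _ mwp _ xE); last 3 first.
  - by rewrite !mulr_gt0.
  - by rewrite mulr_ge0// powR_ge0.
  - by move=> z; exact: powR_ge0.
  apply: ge0_subset_integral => //; first exact: mrestr.
    by move=> z _; rewrite lee_fin powR_ge0.
  apply: (sub_cube _ _ _ _ _ yx).
  have : lam * t <= lam * rho by rewrite ler_pM2l.
  have : 1 * rho <= lam * rho by rewrite ler_pM2r.
  nra.
apply: (@le_trans _ _ (\int[mu]_(z in cube y rho)
    (a%:E + c%:E * (w z `^ p)%:E))%E).
  apply: ge0_le_integral => //.
  - by move=> z _; rewrite lee_fin.
  - exact: mrestr.
  - under eq_fun do rewrite -EFinM -EFinD.
    by apply: mrestr; apply: measurable_funD => //; exact: measurable_funM.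
  - by move=> z _; rewrite -EFinM -EFinD lee_fin le_young.
have mc : measurable_fun (cube y rho) (fun z => (c%:E * (w z `^ p)%:E)%E).
  under eq_fun do rewrite -EFinM.
  by apply: mrestr; exact: measurable_funM.
rewrite ge0_integralD//; last 2 first.
- by move=> z _; rewrite lee_fin ltW.
- by move=> z _; rewrite -EFinM lee_fin mulr_ge0// powR_ge0.
rewrite integral_cst// ge0_integralZl_EFin//; last 2 first.
- by move=> z _; rewrite lee_fin powR_ge0.
- exact: mrestr.
apply: (@le_trans _ _ (a%:E * mu (cube y rho) +
    c%:E * (2 * s `^ p * (8 * lam * rho) ^+ d)%:E)%E).
  by rewrite leeD2l// lee_wpmul2l.
rewrite lebesgue_cube ?(ltW rho0)// -!EFinM -EFinD lee_fin.
rewrite le_eqVlt; apply/orP; left; apply/eqP.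
rewrite -[in RHS]cE -[in LHS]cE !exprMn; ring.
Qed.

Lemma log_maximal_member_le eta (gamma beta p : R) : averaging_kernel eta ->
  1 < gamma -> 1 <= p -> d%:R * (gamma - 1) / p <= 2 * beta ->
  exists2 C : R, 0 < C & forall w (s t : R) x y,
    measurable_fun setT w -> (forall z, 0 <= w z) -> 0 < s ->
    ~ exceptional p w s x -> 0 < t -> t < expR (- 1) ->
    euclid_norm (y - x) <= log_aperture gamma t ->
    ((ln (t^-1) `^ (- (2 * beta)))%:E * average eta t w y <= (C * s)%:E)%E.
Proof.
move=> heta gamma1 p1 hbeta; have [K K0 hK] := average_le _ heta.
have C0 : 0 < (2 ^+ d + 2 * 8 ^+ d) :> R by rewrite addr_gt0 ?mulr_gt0 ?exprn_gt0.
exists (K * (2 ^+ d + 2 * 8 ^+ d)); first exact: mulr_gt0.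
move=> w s t x y mw w0 s0 xE t0 te yx.
have L1 := ln_inv_ge1 _ t0 te; set L := ln t^-1 in L1 *.
have L0 : 0 < L by rewrite (lt_le_trans ltr01).
pose lam := L `^ (gamma - 1).
have lam1 : 1 <= lam.
  rewrite /lam -[leLHS](powRr0 L) ler_powR// subr_ge0.
  exact: ltW.
pose a := lam `^ (d%:R / p) * s.
have a0 : 0 <= a by rewrite mulr_ge0 ?powR_ge0// ltW.
have hyx i : `|y ord0 i - x ord0 i| <= lam * t.
  have := coord_le_euclid_norm (y - x) i; rewrite !mxE => /le_trans; apply.
  by rewrite (le_trans yx)// mulrC.
have avg : (average eta t w y <= (K * ((2 ^+ d + 2 * 8 ^+ d) * a))%:E)%E.
  apply: hK => //; first by rewrite mulr_ge0// ltW.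
  move=> j; apply: (integral_cube_le p _ _ _ t x) => //.
  by rewrite ler_peMl ?(ltW t0)// exprn_ege1// ler1n.
apply: le_trans (lee_wpmul2l _ avg) _; first by rewrite lee_fin powR_ge0.
rewrite -EFinM lee_fin.
(* The condition relating [beta] and [p] makes the total exponent of [L] nonpositive, and
   [1 <= L]. *)
have : L `^ (- (2 * beta)) * lam `^ (d%:R / p) <= 1.
  rewrite /lam -powRrM -powRD; last by rewrite (gt_eqF L0) implybT.
  rewrite -[leRHS](powRr0 L) ler_powR// addrC subr_le0.
  by rewrite (le_trans _ hbeta)// mulrA [_ * d%:R]mulrC.
set u := _ * _ => u1; rewrite /a.
have -> : L `^ (- (2 * beta)) *
    (K * ((2 ^+ d + 2 * 8 ^+ d) * (lam `^ (d%:R / p) * s))) =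
    K * (2 ^+ d + 2 * 8 ^+ d) * s * u by rewrite /u; ring.
by rewrite ler_piMr// !mulr_ge0// ltW.
Qed.

(** Serves the endpoint [r = oo]: an essential bound controls all cube averages at once, and [2 ^ d]
    is the volume of a cube of radius 1. *)
Lemma average_le_ess_bound eta : averaging_kernel eta ->
  exists2 C : R, 0 < C & forall w (N t : R) y,
    measurable_fun setT w -> (forall z, 0 <= w z) -> 0 <= N ->
    {ae mu, forall z, w z <= N} -> 0 < t ->
    (average eta t w y <= (C * N)%:E)%E.
Proof.
move=> heta; have [K K0 hK] := average_le _ heta.
exists (K * 2 ^+ d); first by rewrite mulr_gt0// exprn_gt0.
move=> w N t y mw w0 N0 wN t0; rewrite -mulrA.
apply: hK => //; first by rewrite mulr_ge0// exprn_ge0.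
move=> j; have mcube : measurable (cube y (2 ^+ j * t)) by exact: measurable_cube.
apply: (@le_trans _ _ (\int[mu]_(z in cube y (2 ^+ j * t)) (cst N%:E) z)%E).
  apply: ae_ge0_le_integral => //.
  - by move=> z _; rewrite lee_fin.
  - by apply/measurable_EFinP; exact: measurable_funTS.
  - by apply: filterS wN => z wz _; rewrite lee_fin.
rewrite integral_cst// lebesgue_cube ?mulr_ge0 ?exprn_ge0 ?(ltW t0)//.
by rewrite -EFinM lee_fin exprMn mulrA [N * _]mulrC.
Qed.
End pointwise.

(** * From level sets to a pointwise majorant *)

Section layer_cake.
Context {R : realType} {d : nat}.
Implicit Types (w eta : 'rV[R]_d -> R) (x y : 'rV[R]_d).
Local Notation mu := (lebesgue_rV R d).

(* If [2 ^ k <= v / C < 2 ^ (k + 1)] then [x] lies in the exceptional set of level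
   [2 ^ k], so one term of [layers] already dominates [v ^ r]. *)
Lemma le_layers (p r : R) w (C : R) (v : \bar R) x : 0 < C -> 0 < r -> (0 <= v)%E ->
  (forall s, 0 < s -> ~ exceptional p w s x -> (v <= (C * s)%:E)%E) ->
  (v <= (2 * C)%:E *
    (layers p r w true x + layers p r w false x) `^ r^-1)%E.
Proof.
move=> C0 r0 v0 hv.
have F0 : (0 <= layers p r w true x + layers p r w false x)%E.
  by rewrite adde_ge0// layers_ge0.
have F_ge b n : exceptional p w (dyadic b n) x ->
    ((dyadic b n `^ r)%:E <= layers p r w true x + layers p r w false x)%E.
  move=> xE; apply: (le_trans (layers_ge _ _ _ _ _ _ xE)).
  by case: b {xE}; [rewrite leeDl|rewrite leeDr]; rewrite ?layers_ge0.
move: F0 F_ge; case: (_ + _)%E => [f f0 hf|_ _|//]; last first.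
  by rewrite poweRyr ?gt_eqF ?invr_gt0// gt0_muley ?leey// lte_fin mulr_gt0.
rewrite poweR_EFin -EFinM; rewrite lee_fin in f0.
rewrite leNgt; apply/negP => fv.
(* As [v] may be infinite, the contradiction is drawn from a real [u] strictly below it. *)
have [u fu uv] : exists2 u : R, 2 * C * f `^ r^-1 < u & (u%:E < v)%E.
  move: v fv {v0 hv} => [v fv|_|//].
    have {}fv : 2 * C * f `^ r^-1 < v by rewrite -lte_fin.
    by exists ((2 * C * f `^ r^-1 + v) / 2); rewrite ?lte_fin ?midf_lt.
  by exists (2 * C * f `^ r^-1 + 1); rewrite ?ltry// ltrDl.
have u0 : 0 < u.
  by apply: le_lt_trans fu; rewrite mulr_ge0 ?powR_ge0// mulr_ge0// ltW.
have [b [n /andP[su us]]] := dyadic_approx _ (divr_gt0 u0 C0).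
have s0 := @dyadic_gt0 R b n.
have xE : exceptional p w (dyadic b n) x.
  apply: contrapT => /hv => /(_ s0) /(lt_le_trans uv); rewrite lte_fin ltNge.
  by rewrite mulrC -ler_pdivlMr// su.
have := hf _ _ xE; rewrite lee_fin => sf.
have : dyadic b n <= f `^ r^-1.
  rewrite -[leLHS]powRr1 ?(ltW s0)// -(@divff _ r) ?gt_eqF// powRrM.
  by rewrite ge0_ler_powR ?nnegrE ?powR_ge0// invr_ge0 ltW.
move: us; rewrite ltr_pdivrMr// => us sf'.
have : C * dyadic b n <= C * f `^ r^-1 by rewrite ler_pM2l.
nra.
Qed.

(** The supremum runs over a nonempty set, as [t0 / 2] with [y = x] shows; this removes the absolute
    value inside the norms. *)
Lemma log_maximal_ge0 eta t0 gamma beta w x :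
  (forall x, 0 <= eta x) -> (forall x, 0 <= w x) -> 0 < t0 -> t0 < expR (-1) ->
  (0 <= log_maximal eta t0 gamma beta w x)%E.
Proof.
move=> eta0 w0 t00 t0e; apply: ereal_sup_ge.
exists ((ln ((t0 / 2)^-1) `^ (- (2 * beta)))%:E * average eta (t0 / 2) w x)%E.
  exists (t0 / 2), x; split => //; [lra|lra|].
  rewrite subrr /euclid_norm big1 ?sqrtr0; last by move=> i _; rewrite mxE expr0n.
  by rewrite /log_aperture mulr_ge0 ?powR_ge0; lra.
rewrite mule_ge0 ?lee_fin ?powR_ge0// integral_ge0// => z _.
by rewrite lee_fin mulr_ge0// mulr_ge0// invr_ge0 exprn_ge0; lra.
Qed.
End layer_cake.

(** * Assembly for finite and infinite exponents *)

Theorem lemma7p1 (R : realType) (d : nat) (k1 : int) (t0 gamma beta : R)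
    (eta : 'rV[R]_d -> R) (hd : (1 <= d)%N)
    (ht0 : t0 = 2 ^ (- k1)) (ht0e : t0 < expR (- 1))
    (heta : averaging_kernel eta) (hgamma : 1 < gamma) :
  (forall r : R, 1 < r -> d%:R * (gamma - 1) / r < 2 * beta ->
    exists C : R, forall w : 'rV[R]_d -> R,
      w \in Lfun (lebesgue_rV R d) r%:E -> (forall x, 0 <= w x) ->
      ('N[lebesgue_rV R d]_(r%:E)[log_maximal eta t0 gamma beta w] <=
       C%:E * 'N[lebesgue_rV R d]_(r%:E)[EFin \o w])%E) /\
  (0 <= beta ->
    exists C : R, forall w : 'rV[R]_d -> R,
      w \in Lfun (lebesgue_rV R d) +oo%E -> (forall x, 0 <= w x) ->
      ('N[lebesgue_rV R d]_(+oo)[log_maximal eta t0 gamma beta w] <=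
       C%:E * 'N[lebesgue_rV R d]_(+oo)[EFin \o w])%E).
Proof.
have t00 : 0 < t0 by rewrite ht0 exprz_gt0.
have [eta0 _ _ _ _] := heta.
have avg0 w t y : 0 < t -> (forall x, 0 <= w x) -> (0 <= average eta t w y)%E.
  move=> tgt0 w0; rewrite integral_ge0// => z _.
  by rewrite lee_fin mulr_ge0// mulr_ge0// invr_ge0 exprn_ge0// ltW.
split => [r r1 hbeta|beta0].
  have r0 : 0 < r by rewrite (lt_trans ltr01).
  have dg0 : 0 <= d%:R * (gamma - 1) by rewrite mulr_ge0// subr_ge0 ltW.
  have beta0 : 0 < 2 * beta by rewrite (le_lt_trans _ hbeta)// divr_ge0// ltW.
  (* The second entry is the least exponent for which the weight absorbs the aperture loss; the
     strict hypothesis puts it below [r]. *)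
  pose p := Num.max 1 (d%:R * (gamma - 1) / (2 * beta)).
  have p1 : 1 <= p by rewrite le_max lexx.
  have pr : p < r by rewrite gt_max r1 ltr_pdivrMr// -ltr_pdivrMl// mulrC.
  have pbeta : d%:R * (gamma - 1) / p <= 2 * beta.
    rewrite ler_pdivrMr ?(lt_le_trans ltr01)// -ler_pdivrMl// mulrC.
    by rewrite le_max lexx orbT.
  have [C C0 hC] := log_maximal_member_le _ _ _ _ heta hgamma p1 pbeta.
  pose K1 : R := 3 ^+ d * dyadic_cst (r - p).
  (* The constant of [le_layers] raised to the power [r], and one copy of [K1] for each value of
     [b]. *)
  pose K := (2 * C) `^ r * (K1 + K1).
  have K10 : 0 <= K1.
    rewrite mulr_ge0 ?exprn_ge0//.
    have rp0 : 0 < r - p by rewrite subr_gt0.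
    by have := @dyadic_sum R true _ 1 0 rp0 ler01; rewrite big_ord0 powR1 mulr1.
  have K0 : 0 <= K by rewrite mulr_ge0 ?powR_ge0 ?addr_ge0.
  exists (K `^ r^-1) => w /andP[/set_mem mw _] w0.
  have mw' : measurable_fun setT w by exact: mw.
  rewrite unlock -poweR_EFin -poweRM ?lee_fin//; last first.
    by apply: integral_ge0 => x _; exact: poweR_ge0.
  have {}rV0 : 0 <= r^-1 by rewrite invr_ge0 ltW.
  apply: (gt0_ler_poweR rV0); rewrite ?in_itv /= ?andbT ?leey ?integral_ge0//;
    do ?by move=> *; exact: poweR_ge0.
    by rewrite andbT mule_ge0 ?lee_fin// integral_ge0// => x _; exact: poweR_ge0.
  pose F x := (layers p r w true x + layers p r w false x)%E.
  have mF : measurable_fun setT F.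
    by apply: emeasurable_funD; exact: measurable_layers.
  have F0 x : (0 <= F x)%E by rewrite adde_ge0// layers_ge0.
  apply: (@le_trans _ _ (\int[lebesgue_rV R d]_x (((2 * C) `^ r)%:E * F x))%E).
    apply: ge0_le_lower_integral => x; first exact: poweR_ge0.
    have : (log_maximal eta t0 gamma beta w x <= (2 * C)%:E * F x `^ r^-1)%E.
      apply: ge_ereal_sup => _ [t [y [tgt0 tt0 yx ->]]].
      apply: le_layers => //; first by rewrite mule_ge0 ?avg0// lee_fin powR_ge0.
      by move=> s s0 xE; apply: (hC w s t x y) => //; exact: lt_trans tt0 ht0e.
    have M0 := log_maximal_ge0 _ _ gamma beta _ x eta0 w0 t00 ht0e.
    rewrite gee0_abs// => hM.
    have C20 : (0 <= (2 * C)%:E)%E by rewrite lee_fin mulr_ge0// ltW.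
    apply: (@le_trans _ _ (((2 * C)%:E * F x `^ r^-1) `^ r)%E).
      apply: (gt0_ler_poweR (ltW r0)) => //; rewrite in_itv /= ?andbT ?leey//.
      by rewrite M0.
      by rewrite mule_ge0// poweR_ge0.
    by rewrite poweRM ?poweR_ge0// -poweRrM mulVf ?gt_eqF// poweRe1.
  rewrite ge0_integralZl_EFin ?powR_ge0// ge0_integralD//;
    [|by move=> *; exact: layers_ge0|exact: measurable_layers|
      by move=> *; exact: layers_ge0|exact: measurable_layers].
  have -> : (\int[lebesgue_rV R d]_x `|(EFin \o w) x| `^ r =
      \int[lebesgue_rV R d]_x (w x `^ r)%:E)%E.
    by apply: eq_integral => x _; rewrite /comp gee0_abs ?lee_fin// poweR_EFin.
  rewrite /K EFinM -muleA lee_wpmul2l ?lee_fin ?powR_ge0//.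
  rewrite EFinD ge0_muleDl ?lee_fin//.
  by rewrite leeD// integral_layers.
have [C C0 hC] := average_le_ess_bound _ heta.
exists C => w /andP[/set_mem mw /set_mem fw] w0.
have mw' : measurable_fun setT w by exact: mw.
move: fw; rewrite /finite_norm /= unlock.
(* The norm has default value 0 if the whole space has measure zero; both sides then vanish. *)
case: ifPn => [mu0 fw|_ _]; last by rewrite mule0.
apply/ess_supP; apply: nearW => x /=.
rewrite gee0_abs; last exact: log_maximal_ge0.
set N := ess_sup _ _ in fw *.
have N0 : (0 <= N)%E.
  by apply: ess_sup_gee => //; apply: nearW => x' /=; rewrite lee_fin.
have Nfin : N \is a fin_num by rewrite ge0_fin_numE.
rewrite -(fineK Nfin) -EFinM.
apply: ge_ereal_sup => _ [t [y [tgt0 tt0 yx ->]]].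
apply: le_trans (hC w (fine N) t y mw' w0 (fine_ge0 N0) _ tgt0).
  (* As [0 <= beta] and the logarithm is at least 1, the weight is at most 1. *)
  rewrite -[leRHS]mul1e lee_wpmul2r ?avg0// lee_fin.
  have L1 : 1 <= ln t^-1 by rewrite ln_inv_ge1// (lt_trans tt0).
  by rewrite -[leRHS](powRr0 (ln t^-1)) ler_powR// oppr_le0 mulr_ge0.
have := ess_sup_ge (lebesgue_rV R d) (abse \o (EFin \o w)).
apply: filterS => z /=; rewrite -/N -[N in (_ <= N)%E](fineK Nfin) lee_fin.
by rewrite ger0_norm.
Qed.
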